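(* Let $K\subset\mathbb{R}^n$ be a convex body in Behrend position, let $\mathrm{D}_K\subseteq\mathbb{S}^{n-1}$ be the set of diametrical directions of $K$, and let $1\le i\le n-1$. Then, for every $i$-dimensional linear subspace $L\subset\mathbb{R}^n$: \begin{enumerate} \item[(i)] there is some $v\in\mathrm{D}_K$ such that $\sphericalangle(L,v)\le\arccos(\sqrt{i/n})$, and \item[(ii)] there is some $w\in\mathrm{D}_K$ such that $\sphericalangle(L,w)\ge\arccos(\sqrt{i/n})$. \end{enumerate} Moreover, the cube $C_n=[-1,1]^n$ (which is in Behrend position) and the subspaces $L_i=\operatorname{lin}\{e_1,\dots,e_i\}$, where $e_k$ is the $k$th coordinate unit vector, show that the bounds cannot be improved: for $K=C_n$ and $L=L_i$, the bound $\arccos(\sqrt{i/n})$ cannot be replaced by a smaller number in (i) nor by a larger number in (ii).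
   Context: A convex body in $\mathbb{R}^n$ is a compact convex set with nonempty interior. $\mathrm{D}(K)=\max\{\|x-y\|:x,y\in K\}$ is the Euclidean diameter, $\mathrm{vol}$ the $n$-dimensional volume, and $\operatorname{idq}(K)=\mathrm{vol}(K)/\mathrm{D}(K)^n$. A convex body $K$ is in Behrend position if $\operatorname{idq}(K)=\max_{A\in \mathrm{GL}_n(\mathbb{R})}\operatorname{idq}(AK)$. The set of diametrical directions is $\mathrm{D}_K=\{(x-y)/\|x-y\| : x,y\in K,\ \|x-y\|=\mathrm{D}(K)\}$. The angle between a linear subspace $L$ and a nonzero vector $v\in\mathbb{R}^n$ is \[ \sphericalangle(L,v)=\min_{z\in L\setminus\{0\}}\arccos\frac{z^{\intercal}v}{\|z\|\,\|v\|}. \] *)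

(* Defs.v *)
From HB Require Import structures.
From mathcomp Require Import all_boot all_order all_algebra.
From mathcomp Require Import all_classical all_reals all_analysis.
Import Order.TTheory GRing.Theory Num.Theory.
Import numFieldNormedType.Exports.

Set Implicit Arguments.
Unset Strict Implicit.
Unset Printing Implicit Defensive.

Local Open Scope classical_set_scope.
Local Open Scope ring_scope.

(* R^n is the space 'rV[R]_n of row vectors.  Its library norm is the max
   norm, so the Euclidean norm is defined here; both give the same topology. *)

Definition dotv (R : realType) (n : nat) (x y : 'rV[R]_n) : R :=
  (x *m y^T) 0 0.

Definition enorm (R : realType) (n : nat) (x : 'rV[R]_n) : R :=
  Num.sqrt (dotv x x).

Definition convex_body (R : realType) (n : nat) (K : set 'rV[R]_n) : Prop :=
  [/\ compact K, @convex_set R 'rV[R]_n K & interior K !=set0].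

(* n-fold product of the one-dimensional Lebesgue measure, over the
   identification of R * R^n with R^(n+1); the product over n = 0 factors is
   the unit mass at the only point. *)
Fixpoint lebesgue_measure_tuple (R : realType) (n : nat) :
    set (n.-tuple (measurableTypeR R)) -> \bar R :=
  match n with
  | 0 => dirac [tuple]
  | m.+1 => pushforward
      (product_measure1 (@lebesgue_measure R) (@lebesgue_measure_tuple R m))
      (fun p : measurableTypeR R * m.-tuple (measurableTypeR R) =>
         [tuple of p.1 :: p.2])
  end.

Definition vol (R : realType) (n : nat) (K : set 'rV[R]_n) : \bar R :=
  lebesgue_measure_tuple [set t : n.-tuple (measurableTypeR R) |
                            K (\row_(j < n) tnth t j)].

(* The supremum is a maximum when K is compact and nonempty. *)
Definition ediam (R : realType) (n : nat) (K : set 'rV[R]_n) : R :=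
  sup [set enorm (x - y) | x in K & y in K].

(* vol K is finite for bounded K, so that fine loses nothing there. *)
Definition idq (R : realType) (n : nat) (K : set 'rV[R]_n) : R :=
  fine (vol K) / ediam K ^+ n.

(* Points are rows, hence x *m A^T is the image of x under the matrix A. *)
Definition mximage (R : realType) (n : nat) (A : 'M[R]_n) (K : set 'rV[R]_n) :
    set 'rV[R]_n :=
  [set x *m A^T | x in K].

Definition is_max (R : realType) (S : set R) (m : R) : Prop :=
  S m /\ ubound S m.

Definition behrend_position (R : realType) (n : nat) (K : set 'rV[R]_n) :
    Prop :=
  is_max [set idq (mximage A K) | A in [set A : 'M[R]_n | A \in unitmx]]
         (idq K).

Definition diametrical_directions (R : realType) (n : nat)
    (K : set 'rV[R]_n) : set 'rV[R]_n :=
  [set v | exists x y, [/\ K x, K y, enorm (x - y) = ediam K &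
                           v = (enorm (x - y))^-1 *: (x - y)]].

(* For L != 0 and v != 0 the infimum is a minimum, attained at the orthogonal
   projection of v on L, or at any nonzero z in L if that projection is 0. *)
Definition angle (R : realType) (n : nat) (L : {vspace 'rV[R]_n})
    (v : 'rV[R]_n) : R :=
  inf [set acos (dotv z v / (enorm z * enorm v)) |
         z in [set z : 'rV[R]_n | z \in L /\ z != 0]].

Definition cube (R : realType) (n : nat) : set 'rV[R]_n :=
  [set x | forall j : 'I_n, -1 <= x 0 j <= 1].
Arguments cube : clear implicits.

(* Indices of 'I_n start at 0: these are the first i unit vectors. *)
Definition coord_subspace (R : realType) (n i : nat) : {vspace 'rV[R]_n} :=
  <<[seq delta_mx ord0 k | k : 'I_n <- enum 'I_n & (k < i)%N]>>%VS.
Arguments coord_subspace : clear implicits.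

(* Main.v *)
(** Let P be the orthogonal projection onto L.  The map 1 + t P multiplies
    volumes by (1 + t)^i, so in Behrend position some x, y in K satisfy
    ||(1 + t P) u||^(2n) >= (1 + t)^(2i) D(K)^(2n) with u = x - y.  Writing
    1 + s = (1 + t)^2, a = ||u||^2 / D(K)^2 and b = ||P u||^2 / D(K)^2, this is
    (a + s b)^n >= (1 + s)^i.  As s tends to 0 from above (below), it forces in
    the limit a = 1 and b >= i/n (b <= i/n), and the angle between L and a
    diametrical direction is arccos (sqrt b).

    The cube is in Behrend position because some sign vector e satisfies
    ||A e||^2 >= sum of the squared norms of the columns of A, which by
    Hadamard's inequality and AM-GM is at least n |det A|^(2/n).

    The linear change of variables for the iterated Lebesgue measure comes from
    Tonelli's theorem: up to adding a row to the first one, an invertible matrix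
    is a product of two maps, each affine along the fibres of R x R^n over one
    factor. *)
Require Import Defs.
From HB Require Import structures.
From mathcomp Require Import all_boot all_order all_algebra.
From mathcomp Require Import all_classical all_reals all_analysis.
From mathcomp Require Import measurable_realfun ring lra.
Import Order.TTheory GRing.Theory Num.Theory.
Import numFieldNormedType.Exports.

Set Implicit Arguments.
Unset Strict Implicit.
Unset Printing Implicit Defensive.

Local Open Scope classical_set_scope.
Local Open Scope ring_scope.

(** * The iterated Lebesgue measure is a sigma-finite measure *)

Lemma sigma_finite_pushforward d1 d2 (T1 : measurableType d1)
    (T2 : measurableType d2) (R : realType) (f : T1 -> T2) (g : T2 -> T1)
    (m : set T1 -> \bar R) :
  sigma_finite setT m -> measurable_fun setT g -> cancel f g ->
  sigma_finite setT (pushforward m f).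
Proof.
move=> [F FT Foo] mg fK.
exists (fun k => g @^-1` F k).
  by rewrite -preimage_bigcup -FT preimage_setT.
move=> k; have [mF Fk] := Foo k; split.
  by rewrite -[X in measurable X]setTI; exact: mg.
rewrite /pushforward; suff -> : f @^-1` (g @^-1` F k) = F k by [].
by rewrite -comp_preimage; apply/seteqP; split => x /=; rewrite fK.
Qed.

(** With increasing covers in both factors, the diagonal rectangles [F k] by [G k] already cover: a
    point of [F i] by [G j] has index [maxn i j]. *)
Lemma sigma_finite_product d1 d2 (T1 : measurableType d1)
    (T2 : measurableType d2) (R : realType)
    (m1 : {sigma_finite_measure set T1 -> \bar R})
    (m2 : {sigma_finite_measure set T2 -> \bar R}) :
  sigma_finite setT (m1 \x m2)%E.
Proof.
have /sigma_finiteP[F [TF ndF Foo]] := sigma_finiteT m1.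
have /sigma_finiteP[G [TG ndG Goo]] := sigma_finiteT m2.
exists (fun k => F k `*` G k) => [|k].
  apply/esym; rewrite -subTset => -[x y] _.
  have [i _ Fx] : (\bigcup_k F k) x by rewrite -TF.
  have [j _ Gy] : (\bigcup_k G k) y by rewrite -TG.
  exists (maxn i j) => //; split => /=.
    by move: Fx; apply/subsetPset/ndF/leq_maxl.
  by move: Gy; apply/subsetPset/ndG/leq_maxr.
have [mF Fk] := Foo k; have [mG Gk] := Goo k; split; first exact: measurableX.
by rewrite product_measure1E// lte_mul_pinfty// ge0_fin_numE.
Qed.

Definition pushforward_measure d1 d2 (T1 : measurableType d1)
    (T2 : measurableType d2) (R : realType) (m : {measure set T1 -> \bar R})
    (f : T1 -> T2) (mf : measurable_fun setT f) :
    {measure set T2 -> \bar R} :=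
  measure_function_pushforward__canonical__measure_function_Measure m mf.

(** Sigma-finiteness known only as a proposition is packed into a structure, so that Tonelli's
    theorem becomes applicable. *)
Lemma sigma_finite_measure_exists d (T : measurableType d) (R : realType)
    (m : {measure set T -> \bar R}) :
  sigma_finite setT m ->
  exists m' : {sigma_finite_measure set T -> \bar R}, m = m' :> (set T -> \bar R).
Proof.
move=> sm.
pose H1 := isSFinite.Build _ _ _ _ (sfinite_measure_sigma_finite sm).
pose H2 := isSigmaFinite.Build _ _ _ _ sm.
by exists (HB.pack_for (SigmaFiniteMeasure.type T R) (Measure.sort m) H1 H2).
Qed.

Section tuple_measure.
Variable R : realType.
Notation MR := (measurableTypeR R).

Let cons_pair n (p : MR * n.-tuple MR) : n.+1.-tuple MR := [tuple of p.1 :: p.2].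
Let uncons n (t : n.+1.-tuple MR) : MR * n.-tuple MR :=
  (tnth t ord0, [tuple of behead t]).

Let measurable_cons_pair n : measurable_fun setT (@cons_pair n).
Proof. exact: measurable_cons. Qed.

Let measurable_uncons n : measurable_fun setT (@uncons n).
Proof.
apply/measurable_fun_pairP; split => /=.
  exact: measurable_tnth.
exact: measurable_behead.
Qed.

(** The recursive definition yields a bare set function. This recovers the measure structure behind
    it, one factor at a time. *)
Lemma lebesgue_measure_tuple_sigma_finite n :
  exists m : {sigma_finite_measure set (n.-tuple MR) -> \bar R},
    @lebesgue_measure_tuple R n = m.
Proof.
elim: n => [|n [m IH]].
  by exists (@dirac _ _ ([tuple] : 0.-tuple MR) R).
have consK : cancel (@cons_pair n) (@uncons n).
  by move=> [x t]; rewrite /uncons /cons_pair/=; congr (_, _); exact: val_inj.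
rewrite /= IH.
apply: (@sigma_finite_measure_exists _ _ R (pushforward_measure
  (@lebesgue_measure R \x m)%E (@measurable_cons_pair n))).
exact: sigma_finite_pushforward (sigma_finite_product _ _)
  (@measurable_uncons n) consK.
Qed.

End tuple_measure.

(** * Fubini for [vol] *)

Section volume.
Variable R : realType.
Notation MR := (measurableTypeR R).

Definition row_of_tuple n (t : n.-tuple MR) : 'rV[R]_n := \row_j tnth t j.

(* Matrix types carry no sigma-algebra: that of tuples is used instead. *)
Definition row_measurable n (K : set 'rV[R]_n) : Prop :=
  measurable (@row_of_tuple n @^-1` K).

(** The map [f] factors through tuples, where measurability is checked coordinate by coordinate. *)
Lemma measurable_row_preimage d (T : measurableType d) n (f : T -> 'rV[R]_n)
    (K : set 'rV[R]_n) :
  (forall j, measurable_fun setT (fun x => f x 0 j : MR)) ->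
  row_measurable K -> measurable (f @^-1` K).
Proof.
move=> mf mK; pose g x : n.-tuple MR := [tuple f x 0 j | j < n].
have mg : measurable_fun setT g.
  apply/measurable_fun_tnthP => j; rewrite (_ : _ \o _ = fun x => f x 0 j)//.
  by apply/funext => x /=; rewrite tnth_mktuple.
have -> : f = @row_of_tuple n \o g.
  by apply/funext => x; apply/rowP => j; rewrite mxE tnth_mktuple.
by rewrite comp_preimage -[X in measurable X]setTI; exact: mg.
Qed.

Lemma row_measurable_affine m n (A : 'M[R]_(m, n)) (b : 'rV_n) K :
  row_measurable K -> row_measurable ((fun z => z *m A + b) @^-1` K).
Proof.
move=> mK; rewrite /row_measurable -comp_preimage.
apply: measurable_row_preimage mK => j /=.
rewrite (_ : (fun _ => _) = fun t : m.-tuple MR =>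
    \sum_k tnth t k * A k j + b 0 j); last first.
  by apply/funext => t; rewrite !mxE; under eq_bigr do rewrite mxE.
apply: measurable_funD => //; apply: measurable_sum => k.
by apply: measurable_funM => //; exact: measurable_tnth.
Qed.

Lemma row_of_tuple_cons n (x : MR) (t : n.-tuple MR) :
  row_of_tuple [tuple of x :: t] = row_mx x%:M (row_of_tuple t) :> 'rV_(1 + n).
Proof.
apply/rowP => j; rewrite !mxE; case: splitP => k jk; rewrite !mxE.
  by rewrite (ord1 k) mulr1n (_ : j = ord0)//; apply: val_inj; rewrite /= jk ord1.
by rewrite (_ : j = lift ord0 k) ?tnthS//; apply: val_inj.
Qed.

(** This integral is the definition of [product_measure1], so it is available for every set [K]. *)
Lemma vol_xsection n (K : set 'rV[R]_(1 + n)) :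
  vol K = (\int[lebesgue_measure]_(x in [set: MR])
            vol [set y | K (row_mx x%:M y)])%E.
Proof.
rewrite [LHS]/vol /= /pushforward /product_measure1; apply: eq_integral => x _.
rewrite /= /vol; congr (lebesgue_measure_tuple _); apply/seteqP.
by split => t; rewrite /xsection /= inE/= -row_of_tuple_cons.
Qed.

Let pair_row n (p : MR * n.-tuple MR) : 'rV[R]_(1 + n) :=
  row_mx p.1%:M (row_of_tuple p.2).

Let measurable_pair_row n K : row_measurable K -> measurable (@pair_row n @^-1` K).
Proof.
apply: measurable_row_preimage => j; rewrite /pair_row.
case: (split_ordP j) => k ->.
  rewrite (_ : (fun _ => _) = fst)//; apply/funext => p.
  by rewrite row_mxEl mxE (ord1 k) mulr1n.
rewrite (_ : (fun _ => _) = (fun t => tnth t k) \o snd).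
  by apply: measurableT_comp => //; exact: measurable_tnth.
by apply/funext => p; rewrite row_mxEr mxE.
Qed.

Lemma row_measurable_xsection n (K : set 'rV[R]_(1 + n)) x :
  row_measurable K -> row_measurable [set y | K (row_mx x%:M y)].
Proof.
move=> /measurable_pair_row /(measurable_xsection x).
rewrite /row_measurable /xsection; congr measurable; apply/seteqP.
by split => t /=; rewrite inE.
Qed.

Lemma measurable_vol_xsection n (K : set 'rV[R]_(1 + n)) :
  row_measurable K ->
  measurable_fun [set: MR] (fun x => vol [set y | K (row_mx x%:M y)]).
Proof.
move=> /measurable_pair_row mK.
have [m mE] := @lebesgue_measure_tuple_sigma_finite R n.
have := measurable_fun_xsection m mK; congr measurable_fun; apply/funext => x /=.
rewrite /vol mE; congr (m _); apply/seteqP.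
by split => t /=; rewrite /xsection/= inE.
Qed.

Lemma row_measurable_ysection n (K : set 'rV[R]_(1 + n)) y :
  row_measurable K -> measurable [set x : MR | K (row_mx x%:M y)].
Proof.
move=> mK.
apply: (measurable_row_preimage (f := fun x : MR => row_mx x%:M y) _ mK) => j.
case: (split_ordP j) => k ->.
  rewrite (_ : (fun _ => _) = id)//; apply/funext => p.
  by rewrite row_mxEl mxE (ord1 k) mulr1n.
rewrite (_ : (fun _ => _) = cst (y 0 k)) //.
by apply/funext => p; rewrite row_mxEr.
Qed.

Lemma measurable_lebesgue_ysection n (K : set 'rV[R]_(1 + n)) :
  row_measurable K -> measurable_fun setT (fun t : n.-tuple MR =>
    lebesgue_measure [set x : MR | K (row_mx x%:M (row_of_tuple t))]).
Proof.
move=> /measurable_pair_row mK.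
have := measurable_fun_ysection (@lebesgue_measure R) mK.
congr measurable_fun; apply/funext => t /=; congr (lebesgue_measure _).
by apply/seteqP; split => x /=; rewrite /ysection/= inE.
Qed.

(** Integrating in the other order defines [\x^], which agrees with [\x] on measurable rectangles
    and hence on all measurable sets. *)
Lemma vol_ysection n (K : set 'rV[R]_(1 + n)) : row_measurable K ->
  vol K = (\int[@lebesgue_measure_tuple R n]_t
    lebesgue_measure [set x : MR | K (row_mx x%:M (row_of_tuple t))])%E.
Proof.
move=> /measurable_pair_row mK.
have [m mE] := @lebesgue_measure_tuple_sigma_finite R n.
rewrite [LHS]/vol /= /pushforward mE.
rewrite [LHS](_ : _ = (lebesgue_measure \x m) (@pair_row n @^-1` K))%E; last first.
  congr (_ _); apply/seteqP.
  by split => -[x t] /=; rewrite /pair_row /= -row_of_tuple_cons.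
rewrite (product_measure_unique (m' := (lebesgue_measure \x^ m)%E))//; last first.
  by move=> A B mA mB; exact: product_measure2E.
apply: eq_integral => t _ /=; congr (lebesgue_measure _).
by apply/seteqP; split => x /=; rewrite /ysection/= inE.
Qed.
End volume.

(** * Linear change of variables *)

Section scaling.
Variable R : realType.
Notation MR := (measurableTypeR R).

(** As a function of [S], the left side is a measure; it equals Lebesgue measure once the two agree
    on half-open intervals. *)
Lemma lebesgue_measure_affine (a b : R) (S : set MR) : a != 0 -> measurable S ->
  (`|a|%:E * lebesgue_measure ([set x | S (a * x + b)%R] : set MR))%E =
  lebesgue_measure S.
Proof.
move=> a0 mS; pose f (x : MR) : MR := a * x + b.
have mf : measurable_fun setT f by apply: measurable_funD.
pose m : {measure set MR -> \bar R} := mscale (NngNum (normr_ge0 a))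
  (pushforward_measure (@lebesgue_measure R) mf).
suff /(_ S mS) -> : forall A, measurable A -> lebesgue_measure A = m A by [].
apply: lebesgue_measure_unique => _ [[u v]] _ <-.
have -> : m `]u, v]%classic = (`|a|%:E * lebesgue_measure (f @^-1` `]u, v]))%E by [].
have [a_gt0|a_lt0|/eqP] := ltgtP 0 a; last by rewrite eq_sym (negbTE a0).
  have -> : f @^-1` `]u, v] = `](u - b) / a, (v - b) / a]%classic.
    apply/seteqP; split => x /=; rewrite !in_itv/= /f;
      by rewrite ltr_pdivrMr// ler_pdivlMr// ltrBlDr lerBrDr mulrC.
  rewrite !lebesgue_measure_itv/= !lte_fin ltr_pM2r ?invr_gt0// ltrD2r.
  case: ifP => _; last by rewrite mule0.
  by rewrite -!EFinD -EFinM gtr0_norm//; congr EFin; field.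
(* A negative slope exchanges the endpoints, and with them the open and closed sides. *)
have -> : f @^-1` `]u, v] = `[(v - b) / a, (u - b) / a[%classic.
  apply/seteqP; split => x /=; rewrite !in_itv/= /f;
    by rewrite ltr_ndivlMr// ler_ndivrMr// ltrBlDr lerBrDr mulrC andbC.
rewrite !lebesgue_measure_itv/= !lte_fin ltr_nM2r ?invr_lt0// ltrD2r.
case: ifP => _; last by rewrite mule0.
by rewrite -!EFinD -EFinM ltr0_norm//; congr EFin; field.
Qed.

Lemma vol_ge0 n (K : set 'rV[R]_n) : (0 <= vol K)%E.
Proof.
by rewrite /vol; have [m ->] := @lebesgue_measure_tuple_sigma_finite R n.
Qed.

(** Preimages are used because their sections are again preimages of sections. The translation [b]
    is included because a linear map restricted to a fibre is only affine. *)
Definition scales_vol n (A : 'M[R]_n) b := forall K, row_measurable K ->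
  (`|\det A|%:E * vol ((fun z => z *m A + b)%R @^-1` K) = vol K)%E.

Lemma scales_vol_comp n (A B : 'M[R]_n) a b :
  scales_vol A a -> scales_vol B b -> scales_vol (A *m B) (a *m B + b).
Proof.
move=> sA sB K mK; rewrite -[in RHS](sB K mK) det_mulmx normrM EFinM (muleC `|_|%:E).
rewrite -muleA -[in RHS](sA _ (row_measurable_affine _ _ mK)).
congr (_ * (_ * vol _))%E; apply/funext => z /=; congr (K _).
by rewrite addrA mulmxA mulmxDl.
Qed.

(** Over a fixed [x] the map is [y *m D] plus the translation [x *: c + b], which varies with [x];
    hence the hypothesis for all translations. *)
Lemma scales_vol_xfiber n (c : 'rV[R]_n) (D : 'M[R]_n) (b : 'rV[R]_n) :
  (forall b, scales_vol D b) ->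
  scales_vol (block_mx 1%:M c 0 D : 'M[R]_(1 + n)) (row_mx 0 b).
Proof.
move=> sD K mK; rewrite !vol_xsection det_ublock det1 mul1r.
rewrite -ge0_integralZl_EFin//; last 2 first.
- by move=> x _; exact: vol_ge0.
- exact: measurable_vol_xsection (row_measurable_affine _ _ mK).
apply: eq_integral => x _.
rewrite -[in RHS](sD (x *: c + b)); last exact: row_measurable_xsection.
congr (_ * vol _)%E; apply/funext => y /=; congr (K _).
by rewrite mul_row_block add_row_mx mulmx1 mulmx0 !addr0 mul_scalar_mx addrCA addrA.
Qed.

(** For a fixed [y] the first coordinate undergoes an affine map of the line with slope [a]. *)
Lemma scales_vol_yfiber n (a : R) (c : 'cV[R]_n) (b : R) : a != 0 ->
  scales_vol (block_mx a%:M 0 c 1%:M : 'M[R]_(1 + n)) (row_mx b%:M 0).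
Proof.
move=> a0 K mK; rewrite !vol_ysection//; last exact: row_measurable_affine.
rewrite det_lblock det1 mulr1 det_scalar expr1.
have [m mE] := @lebesgue_measure_tuple_sigma_finite R n.
rewrite mE -ge0_integralZl_EFin//; last first.
  exact: measurable_lebesgue_ysection (row_measurable_affine _ _ mK).
apply: eq_integral => t _; set y := row_of_tuple t.
rewrite -[in RHS](lebesgue_measure_affine ((y *m c) 0 0 + b) a0); last first.
  exact: row_measurable_ysection.
congr (_ * lebesgue_measure _)%E; apply/funext => x /=; congr (K _).
rewrite mul_row_block add_row_mx mulmx1 mulmx0 add0r addr0 -scalar_mxM.
rewrite {1}[y *m c]mx11_scalar -!raddfD/= -addrA (mulrC x).
by [].
Qed.

(* If A 0 0 <> 0, one elimination step factors A into the two fibre maps above;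
   otherwise adding to row 0 a row with nonzero first entry makes it so. *)
Lemma scales_vol_unitmx n (A : 'M[R]_n) b : A \in unitmx -> scales_vol A b.
Proof.
elim: n => [|n IH] in A b *.
  move=> _ K _; rewrite det_mx00 normr1 mul1e; congr vol.
  by apply/funext => z /=; rewrite !(thinmx0 (_ + _)) (thinmx0 z).
have sT1 (c : 'rV[R]_n) D b' : D \in unitmx ->
    scales_vol (block_mx 1%:M c 0 D : 'M[R]_(1 + n)) (row_mx 0 b').
  by move=> uD; apply: scales_vol_xfiber => b2; exact: IH.
rewrite -[n.+1]/(1 + n)%N in A b *.
have sT (A' : 'M[R]_(1 + n)) b' : A' \in unitmx -> A' 0 0 != 0 -> scales_vol A' b'.
  move=> uA a0; set a := A' 0 0 in a0.
  pose w := dlsubmx A'; pose c := a^-1 *: ursubmx A'.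
  pose D := drsubmx A' - w *m c; pose b0 := lsubmx b' 0 0.
  have ulE : ulsubmx A' = a%:M.
    rewrite [LHS]mx11_scalar !mxE /a; congr (A' _ _)%:M; exact: val_inj.
  have AE : A' = block_mx a%:M 0 w 1%:M *m block_mx 1%:M c 0 D.
    rewrite mulmx_block !mulmx1 !mulmx0 !mul0mx !mul1mx !addr0 /D addrC subrK.
    by rewrite mul_scalar_mx /c scalerA divff// scale1r -ulE submxK.
  have bE : b' = row_mx b0%:M 0 *m block_mx 1%:M c 0 D +
                 row_mx 0 (rsubmx b' - b0 *: c).
    rewrite mul_row_block add_row_mx mulmx1 mulmx0 mul0mx !addr0 mul_scalar_mx.
    by rewrite addrC subrK -mx11_scalar hsubmxK.
  rewrite AE bE; apply: scales_vol_comp; first exact: scales_vol_yfiber.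
  apply: sT1; move: uA; rewrite AE unitmx_mul => /andP[_].
  by rewrite !unitmxE det_ublock det1 mul1r.
move=> uA; have [A00|] := eqVneq (A 0 0) 0; last exact: sT.
have [k Ak] : exists k : 'I_n, A (rshift 1 k) 0 != 0.
  apply/existsP; apply: contraTT uA; rewrite negb_exists => /forallP Ak.
  rewrite unitmxE (expand_det_col _ 0) big1 ?unitr0// => i _.
  case: (@split_ordP 1 n i) => j ->; last by rewrite (eqP (negbNE (Ak j))) mul0r.
  by rewrite (ord1 j) (_ : lshift n _ = 0 :> 'I_(1 + n)) ?A00 ?mul0r//; exact: val_inj.
(* [E 1] adds the row with nonzero first entry to row 0; its inverse [E (-1)] has the form handled
   by [sT1]. *)
pose E s : 'M[R]_(1 + n) := block_mx 1%:M (s *: delta_mx 0 k) 0 1%:M.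
have uE s : E s \in unitmx by rewrite unitmxE det_ublock !det1 mulr1 unitr1.
have AE : A = E (-1) *m (E 1 *m A).
  rewrite mulmxA mulmx_block !mulmx1 !mulmx0 !mul0mx !mul1mx !addr0 !add0r.
  by rewrite scaleN1r scale1r addrN -scalar_mx_block mul1mx.
rewrite AE -[b]add0r -[X in X + b](mul0mx _ (E 1 *m A)).
apply: scales_vol_comp.
  by rewrite -(row_mx0 _ _ 1 n); apply: sT1; exact: unitmx1.
apply: sT; first by rewrite unitmx_mul uE.
rewrite -{1}[A]vsubmxK mul_block_col !mul1mx mul0mx add0r scale1r -rowE.
have lshift0E : lshift n 0 = 0 :> 'I_(1 + n) by exact: val_inj.
rewrite -[X in col_mx _ _ X]lshift0E col_mxEu !mxE lshift0E.
by rewrite A00 add0r.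
Qed.

End scaling.

(** * Volume of convex bodies *)

Section body_volume.
Variable R : realType.
Notation MR := (measurableTypeR R).

Lemma row_measurable_box n (I : 'I_n -> set MR) :
  (forall j, measurable (I j)) ->
  row_measurable [set x : 'rV[R]_n | forall j, I j (x 0 j)].
Proof.
move=> mI; rewrite /row_measurable.
rewrite (_ : _ @^-1` _ = 
    \bigcap_(j in [set: 'I_n]) (fun t : n.-tuple MR => tnth t j) @^-1` I j).
  apply: fin_bigcap_measurable => // j _; rewrite -[X in measurable X]setTI.
  exact: measurable_tnth.
apply/seteqP; split => t /= tI j; first by move: (tI j); rewrite mxE.
by rewrite mxE; exact: tI.
Qed.

Lemma vol_box n (I : 'I_n -> set MR) (c : R) : (forall j, measurable (I j)) ->
  (forall j, lebesgue_measure (I j) = c%:E) ->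
  vol [set x : 'rV[R]_n | forall j, I j (x 0 j)] = (c ^+ n)%:E.
Proof.
elim: n => [|n IH] in I * => mI cI.
  by rewrite /vol /= expr0 diracE mem_set// => -[].
rewrite (@vol_xsection R n) exprS EFinM -(IH (fun j => I (lift 0 j)))//.
set v := vol _; rewrite -(cI 0) -[X in lebesgue_measure X]setIT.
rewrite -integral_indic// -ge0_integralZr//; last 2 first.
- exact/measurable_EFinP/measurable_indic.
- exact: vol_ge0.
apply: eq_integral => x _ /=; rewrite indicE.
have rowE (y : 'rV[R]_n) : row_mx x%:M y 0 (0 : 'I_(1 + n)) = x.
  have -> : 0 = lshift n 0 :> 'I_(1 + n) by exact: val_inj.
  by rewrite row_mxEl mxE mulr1n.
have rowS (y : 'rV[R]_n) j : row_mx x%:M y 0 (lift 0 j : 'I_(1 + n)) = y 0 j.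
  have -> : lift 0 j = rshift 1 j :> 'I_(1 + n) by exact: val_inj.
  by rewrite row_mxEr.
have [/set_mem Ix|/negP] := boolP (x \in I 0).
  rewrite mul1e /v; congr vol; apply/seteqP; split => y /= yI j.
    by have := yI (lift 0 j); rewrite rowS.
  have [j' ->|->] := unliftP 0 j; first by rewrite rowS.
  by rewrite rowE.
rewrite inE => NIx; rewrite mul0e [X in vol X](_ : _ = set0).
  rewrite /vol; have [m ->] := @lebesgue_measure_tuple_sigma_finite R n.
  exact: measure0.
by apply/seteqP; split => // y /= /(_ 0); rewrite rowE.
Qed.

Lemma le_vol n (K L : set 'rV[R]_n) : row_measurable K -> row_measurable L ->
  K `<=` L -> (vol K <= vol L)%E.
Proof.
move=> mK mL KL; rewrite /vol; have [m ->] := @lebesgue_measure_tuple_sigma_finite R n.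
by apply: le_measure; rewrite ?inE//; exact: preimage_subset.
Qed.

(** An open set is the union of the countably many boxes inside it that have a rational centre and
    radius [k.+1%:R^-1]. *)
Lemma row_measurable_open n (U : set 'rV[R]_n) : open U -> row_measurable U.
Proof.
move=> oU; rewrite /row_measurable.
pose B (p : 'rV[rat]_n * nat) : set 'rV[R]_n :=
  [set x | forall j, ball (ratr (p.1 0 j) : R) p.2.+1%:R^-1 (x 0 j)].
have -> : U = \bigcup_p (if `[< B p `<=` U >] then B p else set0).
  apply/seteqP; split => [x Ux|x [p _]]; last by case: asboolP => // + Bx; exact.
  have /nbhs_ballP[e /= e0 eU] : nbhs x U by exact: open_nbhs_nbhs.
  (* A box of radius below [e / 2] that contains [x] lies in the ball of radius [e] about [x]. *)
  have [k ke] : exists k, k.+1%:R^-1 < e / 2.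
    have /ltr_add_invr[k] : 0 < e / 2 by rewrite divr_gt0.
    by rewrite add0r; exists k.
  have qP j : exists q : rat, ball (ratr q : R) k.+1%:R^-1 (x 0 j).
    have : x 0 j - k.+1%:R^-1 < x 0 j by rewrite ltrBlDr ltrDl.
    move=> /rat_in_itvoo[q]; rewrite in_itv/= => /andP[q1 q2]; exists q.
    rewrite /ball/= ltr_distlC; apply/andP; split.
      by rewrite ltrBlDr (lt_trans q2)// ltrDl.
    by rewrite -ltrBlDr.
  pose q : 'rV[rat]_n := \row_j projT1 (cid (qP j)).
  have qE j : ball (ratr (q 0 j) : R) k.+1%:R^-1 (x 0 j).
    by rewrite mxE; exact: (projT2 (cid (qP j))).
  exists (q, k) => //; case: asboolP => // -[] y By; apply: eU.
  split => // i j; rewrite (ord1 i).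
  have := By j; have := qE j; rewrite /ball/= => qx qy.
  rewrite (le_lt_trans (ler_distD (ratr (q 0 j)) _ _))// (splitr e).
  by rewrite ltrD// ?(lt_trans _ ke)// distrC.
rewrite preimage_bigcup; apply: countable_bigcupT_measurable => [|p].
  exact: countableP.
case: asboolP => _; last by rewrite preimage_set0.
apply: (@row_measurable_box _ (fun j => ball (ratr (p.1 0 j) : R) p.2.+1%:R^-1 : set MR)).
by move=> j; exact: measurable_ball.
Qed.

Lemma row_measurable_compact n (K : set 'rV[R]_n) : compact K -> row_measurable K.
Proof.
move=> /(compact_closed (@norm_hausdorff _ _)) cK.
have /row_measurable_open/measurableC : open (~` K) by rewrite openC.
by rewrite /row_measurable -preimage_setC setCK.
Qed.

Lemma vol_compact_fin n (K : set 'rV[R]_n) : compact K -> (vol K < +oo)%E.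
Proof.
move=> cK; have [M [_ MK]] := compact_bounded cK.
(* The bound holds for every number above [M]; this one is also positive, as the side of a box must
   be. *)
have {MK} := MK (`|M| + 1); rewrite (le_lt_trans (ler_norm _))// ?ltrDl//.
move=> /(_ isT); set c := _ + 1 => KM; have c0 : 0 < c by rewrite ltr_wpDl.
apply: (@le_lt_trans _ _ ((2 * c) ^+ n)%:E); last exact: ltry.
rewrite -(@vol_box n (fun=> `[- c, c]%classic : set MR)) => [||j].
- apply: le_vol; first exact: row_measurable_compact.
    exact: (@row_measurable_box _ (fun=> `[- c, c]%classic : set MR)).
  move=> x /KM xM j; rewrite /= in_itv/= -ler_norml (le_trans _ xM)//.
  have -> : `|x| = mx_norm x by [].
  by rewrite mx_normrE; exact: (le_bigmax _ _ (ord0, j)).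
- by [].
- rewrite lebesgue_measure_itv /= lte_fin gtrN// -EFinD; congr EFin; ring.
Qed.

Lemma vol_interior_gt0 n (K : set 'rV[R]_n) : row_measurable K ->
  interior K !=set0 -> (0 < vol K)%E.
Proof.
move=> mK [x /nbhs_ballP[e /= e0 eK]].
apply: (@lt_le_trans _ _ ((2 * e) ^+ n)%:E); first by rewrite lte_fin exprn_gt0// mulr_gt0.
rewrite -(@vol_box n (fun j => ball (x 0 j : R) e : set MR)) => [||j].
- apply: le_vol => //; first apply: (@row_measurable_box _
      (fun j => ball (x 0 j : R) e : set MR)) => j; first exact: measurable_ball.
  by move=> y yB; apply: eK; split => // i j; rewrite (ord1 i); exact: yB.
- by move=> j; exact: measurable_ball.
- by rewrite lebesgue_measure_ball ?mulr_natl// ltW.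
Qed.

(** The image under [A] is the preimage under the inverse map, to which [scales_vol_unitmx]
    applies. *)
Lemma vol_mximage n (A : 'M[R]_n) K : A \in unitmx -> row_measurable K ->
  (vol (mximage A K) = `|\det A|%:E * vol K)%E.
Proof.
move=> uA mK; have uAT : invmx A^T \in unitmx by rewrite unitmx_inv unitmx_tr.
rewrite -(scales_vol_unitmx 0 uAT mK) muleA -EFinM -normrM -[\det A]det_tr.
rewrite det_inv mulfV ?normr1 ?mul1e; last by rewrite det_tr -unitfE -unitmxE.
congr vol; apply/seteqP; split => [_ [x Kx <-]|x /= Kx].
  by rewrite /= addr0 mulmxK// unitmx_tr.
by exists (x *m invmx A^T); rewrite ?mulmxKV ?unitmx_tr//; move: Kx; rewrite addr0.
Qed.
End body_volume.

(** * Euclidean linear algebra *)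

Section euclid.
Variable R : realType.

Lemma dotvE n (x y : 'rV[R]_n) : dotv x y = \sum_j x 0 j * y 0 j.
Proof. by rewrite /dotv mxE; apply: eq_bigr => j _; rewrite mxE. Qed.

Lemma dotvC n (x y : 'rV[R]_n) : dotv x y = dotv y x.
Proof. by rewrite !dotvE; apply: eq_bigr => j _; rewrite mulrC. Qed.

Lemma dotvDl n (x y z : 'rV[R]_n) : dotv (x + y) z = dotv x z + dotv y z.
Proof. by rewrite /dotv mulmxDl mxE. Qed.

Lemma dotvZl n a (x z : 'rV[R]_n) : dotv (a *: x) z = a * dotv x z.
Proof. by rewrite /dotv -scalemxAl mxE. Qed.

Lemma dotvDr n (x y z : 'rV[R]_n) : dotv z (x + y) = dotv z x + dotv z y.
Proof. by rewrite dotvC dotvDl !(dotvC z). Qed.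

Lemma dotvZr n a (x z : 'rV[R]_n) : dotv z (a *: x) = a * dotv z x.
Proof. by rewrite dotvC dotvZl (dotvC z). Qed.

Lemma dotv0l n (x : 'rV[R]_n) : dotv 0 x = 0.
Proof. by rewrite /dotv mul0mx mxE. Qed.

Lemma dotv_ge0 n (x : 'rV[R]_n) : 0 <= dotv x x.
Proof. by rewrite dotvE sumr_ge0// => j _; rewrite -expr2 sqr_ge0. Qed.

Lemma dotv_eq0 n (x : 'rV[R]_n) : (dotv x x == 0) = (x == 0).
Proof.
apply/eqP/eqP => [|->]; last exact: dotv0l.
rewrite dotvE => /eqP; rewrite psumr_eq0 => [/allP x0|j _]; last by rewrite -expr2 sqr_ge0.
apply/rowP => j; rewrite mxE; have := x0 j (mem_index_enum j).
by rewrite -expr2 sqrf_eq0 => /eqP.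
Qed.

Lemma dotv_gt0 n (x : 'rV[R]_n) : (0 < dotv x x) = (x != 0).
Proof. by rewrite lt_def dotv_ge0 andbT dotv_eq0. Qed.

(** The squared norm of [dotv y y *: x - dotv x y *: y] is [dotv y y] times the difference of the
    two sides. *)
Lemma cauchy_schwarz n (x y : 'rV[R]_n) : dotv x y ^+ 2 <= dotv x x * dotv y y.
Proof.
have [->|y0] := eqVneq y 0; first by rewrite dotvC !dotv0l expr0n mulr0.
have := dotv_ge0 (dotv y y *: x - dotv x y *: y); rewrite -scaleNr.
rewrite !(dotvDl, dotvDr, dotvZl, dotvZr) (dotvC y x); rewrite -dotv_gt0 in y0.
set a := dotv x x; set b := dotv x y; set c := dotv y y => h.
rewrite -subr_ge0 -(pmulr_rge0 _ y0); apply: le_trans h _.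
by rewrite le_eqVlt; apply/orP; left; apply/eqP; rewrite -/c; ring.
Qed.

Lemma enorm_ge0 n (x : 'rV[R]_n) : 0 <= enorm x.
Proof. exact: sqrtr_ge0. Qed.

Lemma sqr_enorm n (x : 'rV[R]_n) : enorm x ^+ 2 = dotv x x.
Proof. by rewrite sqr_sqrtr// dotv_ge0. Qed.

Lemma enorm_eq0 n (x : 'rV[R]_n) : (enorm x == 0) = (x == 0).
Proof. by rewrite -sqrf_eq0 sqr_enorm dotv_eq0. Qed.

Lemma enorm_gt0 n (x : 'rV[R]_n) : (0 < enorm x) = (x != 0).
Proof. by rewrite lt_def enorm_ge0 andbT enorm_eq0. Qed.

Lemma enormZ n a (x : 'rV[R]_n) : enorm (a *: x) = `|a| * enorm x.
Proof. by rewrite /enorm dotvZl dotvZr mulrA -expr2 sqrtrM ?sqr_ge0// sqrtr_sqr. Qed.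

Lemma ler_dotv n (x y : 'rV[R]_n) : `|dotv x y| <= enorm x * enorm y.
Proof.
rewrite -[leRHS]ger0_norm ?mulr_ge0 ?enorm_ge0//.
by rewrite -ler_sqr ?nnegrE// !real_normK ?num_real// exprMn !sqr_enorm cauchy_schwarz.
Qed.

(** Sylvester's identity: one block matrix is factored into block triangular matrices in two
    ways. *)
Lemma det_1Dmulmx m n (X : 'M[R]_(n, m)) (Y : 'M[R]_(m, n)) :
  \det (1%:M + X *m Y) = \det (1%:M + Y *m X).
Proof.
have e1 : block_mx 1%:M (- X) Y 1%:M =
    block_mx 1%:M 0 Y 1%:M *m block_mx 1%:M (- X) 0 (1%:M + Y *m X).
  by rewrite mulmx_block !mulmx1 !mul1mx !mulmx0 !mul0mx !addr0 mulmxN addrCA addNr addr0.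
have e2 : block_mx 1%:M (- X) Y 1%:M =
    block_mx (1%:M + X *m Y) (- X) 0 1%:M *m block_mx 1%:M 0 Y 1%:M.
  by rewrite mulmx_block !mulmx1 !mul1mx !mulmx0 !add0r mulNmx addrK.
have := congr1 determinant e1; rewrite e2 !det_mulmx !det_ublock !det_lblock.
by rewrite !det1 !mul1r !mulr1.
Qed.

Definition gram m n (B : 'M[R]_(m, n)) : 'M[R]_m := B *m B^T.

Lemma gram_unitmx m n (B : 'M[R]_(m, n)) : row_free B -> gram B \in unitmx.
Proof.
move=> fB; rewrite -row_free_unit; apply: inj_row_free => v vG.
apply: (row_free_inj fB); rewrite mul0mx; apply/eqP; rewrite -dotv_eq0 /dotv.
by rewrite trmx_mul mulmxA -(mulmxA v) vG mul0mx mxE.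
Qed.

Lemma gram_tr m n (B : 'M[R]_(m, n)) : (gram B)^T = gram B.
Proof. by rewrite trmx_mul trmxK. Qed.

(** For [B] of full row rank this is the orthogonal projection onto its row space, acting on rows
    from the right. *)
Definition rowproj m n (B : 'M[R]_(m, n)) : 'M[R]_n := B^T *m invmx (gram B) *m B.

Lemma rowproj_tr m n (B : 'M[R]_(m, n)) : (rowproj B)^T = rowproj B.
Proof. by rewrite !trmx_mul trmxK trmx_inv gram_tr mulmxA. Qed.

Lemma mul_rowproj m n (B : 'M[R]_(m, n)) : row_free B -> B *m rowproj B = B.
Proof. by move=> /gram_unitmx uG; rewrite /rowproj !mulmxA mulmxV// mul1mx. Qed.

Lemma rowproj_idem m n (B : 'M[R]_(m, n)) : row_free B ->
  rowproj B *m rowproj B = rowproj B.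
Proof. by move=> fB; rewrite {1}/rowproj -mulmxA mul_rowproj. Qed.

(** Sylvester's identity moves the factor [B] to the front, where [gram B] cancels and leaves a
    scalar matrix of size [m]. *)
Lemma det_1D_rowproj m n (B : 'M[R]_(m, n)) t : row_free B ->
  \det (1%:M + t *: rowproj B) = (1 + t) ^+ m.
Proof.
move=> /gram_unitmx uG; rewrite /rowproj -mulmxA scalemxAl det_1Dmulmx.
by rewrite -scalemxAr -mulmxA mulVmx// scalemx1 -raddfD det_scalar.
Qed.

Lemma dotv_symidem n (P : 'M[R]_n) (x y : 'rV_n) : P^T = P -> P *m P = P ->
  dotv (x *m P) (y *m P) = dotv x (y *m P).
Proof. by move=> Pt PP; rewrite /dotv trmx_mul Pt -mulmxA (mulmxA P) PP. Qed.

Lemma dotv_sym n (P : 'M[R]_n) (x y : 'rV_n) : P^T = P ->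
  dotv (x *m P) y = dotv x (y *m P).
Proof. by move=> Pt; rewrite /dotv trmx_mul Pt -mulmxA. Qed.

(* Schur complement: dropping the first row a of A divides the Gram determinant
   by the squared distance of a to the span of the other rows. *)
Lemma hadamard_gram m n (A : 'M[R]_(m, n)) : row_free A ->
  0 <= \det (gram A) <= \prod_i gram A i i.
Proof.
elim: m => [|m IH] in A * => [_|]; first by rewrite det_mx00 big_ord0 ler01 lexx.
rewrite -[m.+1]/(1 + m)%N in A *; rewrite -(vsubmxK A).
set a := usubmx A; set B := dsubmx A => fA.
have fB : row_free B.
  apply: inj_row_free => v vB.
  have : row_mx 0 v *m col_mx a B = 0 by rewrite mul_row_col mul0mx add0r.
  rewrite -(mul0mx 1 (col_mx a B)) => /(row_free_inj fA).
  by rewrite -[RHS]row_mx0 => /eq_row_mx[].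
have uG := gram_unitmx fB; have /andP[G0 Gle] := IH _ fB.
have gramE : gram (col_mx a B) = block_mx (a *m a^T) (a *m B^T) (B *m a^T) (gram B).
  by rewrite /gram tr_col_mx mul_col_row.
have detE : \det (gram (col_mx a B)) =
    (dotv a a - dotv (a *m rowproj B) (a *m rowproj B)) * \det (gram B).
  have -> : gram (col_mx a B) =
      block_mx 1%:M (a *m B^T *m invmx (gram B)) 0 1%:M *m
      block_mx (a *m a^T - a *m rowproj B *m a^T) 0 (B *m a^T) (gram B).
    rewrite mulmx_block !mul1mx !mul0mx !add0r gramE mulmxKV//.
    by rewrite /rowproj !mulmxA subrK.
  rewrite det_mulmx det_ublock !det1 !mul1r det_lblock det_mx11; congr (_ * _).
  rewrite dotv_symidem ?rowproj_tr ?rowproj_idem// mxE /dotv; congr (_ + _).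
  by rewrite mxE trmx_mul rowproj_tr !mulmxA.
(* By Pythagoras this is the squared norm of [a - a *m rowproj B]. *)
have h0 : 0 <= dotv a a - dotv (a *m rowproj B) (a *m rowproj B).
  have := dotv_ge0 (a - a *m rowproj B).
  rewrite -scaleN1r !(dotvDl, dotvDr, dotvZl, dotvZr).
  rewrite (dotv_symidem a a) ?rowproj_tr ?rowproj_idem//.
  rewrite (dotvC _ a); lra.
rewrite detE mulr_ge0//= big_split_ord big_ord1; apply: ler_pM => //.
  by rewrite gramE block_mxEul lerBlDr lerDl dotv_ge0.
rewrite (eq_bigr (fun i => gram B i i))// => i _.
by rewrite gramE block_mxEdr.
Qed.

(** Hadamard's inequality, followed by AM-GM for the squared row norms. *)
Lemma sqr_det_le n (A : 'M[R]_n) : A \in unitmx ->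
  \det A ^+ 2 <= ((\sum_i dotv (row i A) (row i A)) / n%:R) ^+ n.
Proof.
rewrite -row_free_unit => /hadamard_gram/andP[_].
rewrite det_mulmx det_tr -expr2 => /le_trans; apply.
have gE i : gram A i i = dotv (row i A) (row i A).
  by rewrite dotvE mxE; apply: eq_bigr => j _; rewrite !mxE.
under eq_bigr do rewrite gE.
have := @leif_AGM R 'I_n predT (fun i => dotv (row i A) (row i A)).
by rewrite card_ord /= => /(_ (fun i _ => dotv_ge0 _)) [].
Qed.

(** Signs are chosen one at a time, each making the inner product of its vector with the signed sum
    of the later ones nonnegative, so cross terms only help. *)
Lemma sign_sum n m (a : 'I_n -> 'rV[R]_m) : exists e : 'I_n -> R,
  (forall j, `|e j| = 1) /\
  \sum_j dotv (a j) (a j) <= dotv (\sum_j e j *: a j) (\sum_j e j *: a j).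
Proof.
elim: n => [|n IH] in a *.
  by exists (fun=> 1); rewrite !big_ord0 dotv0l normr1.
have [e [e1 le_e]] := IH (fun j => a (lift ord0 j)).
set s := \sum_j e j *: _ in le_e.
pose e0 : R := if 0 <= dotv (a ord0) s then 1 else -1.
exists (fun j => if unlift ord0 j is Some k then e k else e0); split => [j|].
  by case: unliftP => [k _|_]; rewrite ?e1// /e0; case: ifP; rewrite ?normrN normr1.
rewrite !big_ord_recl unlift_none.
under [X in dotv (_ + X) _]eq_bigr do rewrite liftK.
under [X in dotv _ (_ + X)]eq_bigr do rewrite liftK.
rewrite -/s !(dotvDl, dotvDr, dotvZl, dotvZr) (dotvC s).
rewrite /e0; case: ifP => [h|/negbT]; first by lra.
by rewrite -ltNge => h; lra.
Qed.

Lemma orthogonal_projection n (L : {vspace 'rV[R]_n}) :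
  exists P : 'M[R]_n, [/\ P^T = P, P *m P = P, forall v, v *m P \in L,
    {in L, forall v, v *m P = v} &
    forall t, \det (1%:M + t *: P) = (1 + t) ^+ \dim L].
Proof.
pose B := \matrix_(k < \dim L) (vbasis L)`_k.
have mulB (u : 'rV_(\dim L)) : u *m B = \sum_k u 0 k *: (vbasis L)`_k.
  by rewrite mulmx_sum_row; apply: eq_bigr => k _; rewrite rowK.
have fB : row_free B.
  apply: inj_row_free => v; rewrite mulB => /freeP v0.
  by apply/rowP => k; rewrite mxE v0// (basis_free (vbasisP L)).
have BL (u : 'rV_(\dim L)) : u *m B \in L.
  rewrite mulB memv_suml// => k _; rewrite memvZ// vbasis_mem// mem_nth//.
  by rewrite size_tuple.
exists (rowproj B); split.
- exact: rowproj_tr.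
- exact: rowproj_idem.
- by move=> v; rewrite /rowproj !mulmxA; exact: BL.
- move=> v /coord_vbasis vE; pose u := \row_k coord (vbasis L) k v.
  have -> : v = u *m B by rewrite mulB {1}vE; apply: eq_bigr => k _; rewrite mxE.
  by rewrite -mulmxA mul_rowproj.
- by move=> t; rewrite det_1D_rowproj.
Qed.

End euclid.

(** * Angle and diameter *)

Section angles.
Variable R : realType.

Lemma ler_acos (x y : R) : -1 <= x -> x <= y -> y <= 1 -> acos y <= acos x.
Proof.
move=> x1 xy y1; have xI : -1 <= x <= 1 by rewrite x1 (le_trans xy).
have yI : -1 <= y <= 1 by rewrite y1 (le_trans x1).
rewrite leNgt -ltr_cos ?in_itv/= ?acos_ge0 ?acos_lepi//.
by rewrite !acosK ?in_itv//= -leNgt.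
Qed.

(** For [z] in [L] the product with [v] equals that with the projection [p], so Cauchy-Schwarz
    bounds the cosine by [enorm p]. *)
Lemma angleE n (L : {vspace 'rV[R]_n}) (P : 'M[R]_n) (v : 'rV[R]_n) :
  P^T = P -> (forall v, v *m P \in L) -> {in L, forall v, v *m P = v} ->
  (0 < \dim L)%N -> enorm v = 1 -> angle L v = acos (enorm (v *m P)).
Proof.
move=> Pt PL LP L0 v1; set p := v *m P.
have dotp z : z \in L -> dotv z v = dotv z p.
  by move=> zL; rewrite -{1}(LP z zL) dotv_sym.
have p1 : enorm p <= 1.
  have [->|p0] := eqVneq p 0; first by rewrite /enorm dotv0l sqrtr0.
  have := ler_dotv p v; rewrite dotp ?PL// -sqr_enorm ger0_norm ?sqr_ge0//.
  by rewrite expr2 ler_pM2l ?enorm_gt0// v1.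
pose E := [set acos (dotv z v / (enorm z * enorm v)) | z in [set z | z \in L /\ z != 0]].
have E_lb z : z \in L -> z != 0 ->
    acos (enorm p) <= acos (dotv z v / (enorm z * enorm v)).
  move=> zL z0; rewrite v1 mulr1; have z_gt0 : 0 < enorm z by rewrite enorm_gt0.
  have := ler_dotv z p; rewrite -dotp// ler_norml => /andP[lo hi].
  apply: ler_acos => //; last by rewrite ler_pdivrMr// mulrC.
  rewrite ler_pdivlMr// mulN1r (le_trans _ lo)// lerN2.
  by rewrite ler_piMr// enorm_ge0.
have : E (acos (enorm p)).
  (* If [p = 0], all of [L] is orthogonal to [v] and any nonzero vector of [L] attains the infimum;
     otherwise [p] does. *)
  have [p0|p0] := eqVneq p 0.
    exists (vpick L); first by rewrite /= memv_pick vpick0 -dimv_eq0 -lt0n.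
    have -> : enorm p = 0 by apply/eqP; rewrite enorm_eq0 p0.
    by rewrite dotp ?memv_pick// p0 dotvC dotv0l mul0r.
  exists p; first by split; [exact: PL|].
  rewrite v1 mulr1 dotp ?PL// -sqr_enorm expr2 mulfK//.
  by rewrite enorm_eq0.
move=> Ep; rewrite /angle -/E; apply/eqP; rewrite eq_le; apply/andP; split.
  apply: ge_inf => //; exists (acos (enorm p)) => _ [z [zL z0] <-]; exact: E_lb.
apply: lb_le_inf; first by exists (acos (enorm p)).
by move=> _ [z [zL z0] <-]; exact: E_lb.
Qed.

End angles.

Section diameter.
Variables (R : realType) (n : nat).
Implicit Types (K : set 'rV[R]_n) (A M : 'M[R]_n).

(** A function of pairs, so that the extreme value theorem applies on the product of [K] with
    itself. Squares avoid the root and make it a polynomial. *)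
Definition diffsq M (p : 'rV[R]_n * 'rV[R]_n) : R :=
  dotv ((p.1 - p.2) *m M) ((p.1 - p.2) *m M).

Lemma continuous_sumr (T : topologicalType) m (F : 'I_m -> T -> R) :
  (forall j, continuous (F j)) -> continuous (fun x => \sum_j F j x).
Proof.
move=> cF; elim: (index_enum _) => [|j r IH] x.
  rewrite (_ : (fun _ => _) = cst 0); first exact: cst_continuous.
  by apply/funext => y; rewrite big_nil.
rewrite (_ : (fun _ => _) = F j \+ (fun y => \sum_(j <- r) F j y)).
  by apply: continuousD; [exact: cF|exact: IH].
by apply/funext => y; rewrite big_cons.
Qed.

Lemma continuous_diffsq M : continuous (diffsq M).
Proof.
have cF j : continuous (fun p : 'rV[R]_n * 'rV[R]_n => ((p.1 - p.2) *m M) 0 j).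
  rewrite (_ : (fun _ => _) = fun p : 'rV[R]_n * 'rV[R]_n =>
      \sum_k (p.1 0 k - p.2 0 k) * M k j).
    apply: continuous_sumr => k x; apply: cvgM; last exact: cvg_cst.
    apply: cvgB.
      apply: (@continuous_comp _ _ _ fst (fun y : 'rV[R]_n => y 0 k)).
        exact: cvg_fst.
      exact: coord_continuous.
    apply: (@continuous_comp _ _ _ snd (fun y : 'rV[R]_n => y 0 k)).
      exact: cvg_snd.
    exact: coord_continuous.
  by apply/funext => p; rewrite mxE; apply: eq_bigr => k _; rewrite !mxE.
rewrite (_ : diffsq M = fun p : 'rV[R]_n * 'rV[R]_n =>
    \sum_j ((p.1 - p.2) *m M) 0 j * ((p.1 - p.2) *m M) 0 j).
  by apply: continuous_sumr => j x; apply: cvgM; exact: cF.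
by apply/funext => p; rewrite /diffsq dotvE.
Qed.

Lemma ediam_mximage K A : compact K -> K !=set0 ->
  (forall x y, K x -> K y ->
     enorm ((x - y) *m A^T) <= ediam (mximage A K)) /\
  exists x y, [/\ K x, K y & ediam (mximage A K) = enorm ((x - y) *m A^T)].
Proof.
move=> cK [x0 Kx0]; have KK0 : K `*` K !=set0 by exists (x0, x0).
have cf : {within K `*` K, continuous (diffsq A^T)}.
  exact/continuous_subspaceT/continuous_diffsq.
have [[x y] /set_mem[/= Kx Ky] xyM] := compact_EVT_max KK0 (compact_setX cK cK) cf.
pose S := [set enorm (u - v) | u in mximage A K & v in mximage A K].
have Sub : ubound S (enorm ((x - y) *m A^T)).
  move=> _ [_ [u Ku <-] [_ [v Kv <-] <-]]; rewrite -mulmxBl ler_wsqrtr//.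
  by apply: (xyM (u, v)); rewrite inE.
have Sxy u v : K u -> K v -> S (enorm ((u - v) *m A^T)).
  move=> Ku Kv; exists (u *m A^T); first by exists u.
  by exists (v *m A^T); [exists v|rewrite mulmxBl].
have DE : ediam (mximage A K) = enorm ((x - y) *m A^T).
  apply/eqP; rewrite eq_le; apply/andP; split.
    by apply: ge_sup => //; exists (enorm ((x - y) *m A^T)); exact: Sxy.
  by apply: ub_le_sup; [exists (enorm ((x - y) *m A^T))|exact: Sxy].
by split; [move=> u v Ku Kv; rewrite DE; apply/Sub/Sxy|exists x, y].
Qed.

Lemma mximage1 K : mximage 1%:M K = K.
Proof.
apply/seteqP; split => [_ [x Kx <-]|x Kx]; first by rewrite trmx1 mulmx1.
by exists x; rewrite ?trmx1 ?mulmx1.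
Qed.

Lemma ediamP K : compact K -> K !=set0 ->
  (forall x y, K x -> K y -> enorm (x - y) <= ediam K) /\
  exists x y, [/\ K x, K y & ediam K = enorm (x - y)].
Proof.
move=> cK K0; have [] := ediam_mximage 1%:M cK K0; rewrite mximage1 trmx1.
move=> ub [x [y]]; rewrite mulmx1 => xy; split; last by exists x, y.
by move=> u v; rewrite -{1}(mulmx1 (u - v)); exact: ub.
Qed.

Lemma ediam_gt0 K : (0 < n)%N -> convex_body K -> 0 < ediam K.
Proof.
move=> n0 [cK _ [x /nbhs_ballP[e /= e0 eK]]].
have Kx : K x by apply: eK; exact: ballxx.
pose y : 'rV[R]_n := x + const_mx (e / 2).
have Ky : K y.
  apply: eK; split => // i j; rewrite (ord1 i) /ball/= !mxE opprD addrA subrr.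
  by rewrite add0r normrN gtr0_norm ?divr_gt0// ltr_pdivrMr// ltr_pMr// ltr1n.
have [ub _] := ediamP cK (ex_intro _ _ Kx).
apply: lt_le_trans (ub _ _ Ky Kx); rewrite enorm_gt0 /y addrAC subrr add0r.
apply/negP => /eqP/rowP /(_ (Ordinal n0)); rewrite !mxE => /eqP.
by rewrite gt_eqF// divr_gt0.
Qed.

Lemma mximage_ediam_gt0 K A : (0 < n)%N -> convex_body K -> A \in unitmx ->
  0 < ediam (mximage A K).
Proof.
move=> n0 bK uA; have [cK _ [z /nbhs_singleton Kz]] := bK.
have [ub [x [y [Kx Ky xyE]]]] := ediamP cK (ex_intro _ _ Kz).
have [ubA _] := ediam_mximage A cK (ex_intro _ _ Kz).
apply: lt_le_trans (ubA _ _ Kx Ky).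
have := ediam_gt0 n0 bK; rewrite xyE !enorm_gt0; apply: contra => /eqP xy0.
by rewrite -(mulmxK (_ : A^T \in unitmx) (x - y)) ?unitmx_tr// xy0 mul0mx.
Qed.

(** The volume of [K] is positive and finite, so it cancels from both quotients. *)
Lemma idq_leP K A : (0 < n)%N -> convex_body K -> A \in unitmx ->
  (idq (mximage A K) <= idq K) =
  (`|\det A| * ediam K ^+ n <= ediam (mximage A K) ^+ n).
Proof.
move=> n0 bK uA; have [cK _ K0] := bK; have mK := row_measurable_compact cK.
have V0 := vol_interior_gt0 mK K0; have Vf := vol_compact_fin cK.
have Vfin : vol K \is a fin_num by rewrite ge0_fin_numE// ltW.
rewrite /idq vol_mximage// fineM//=.
have v0 : 0 < fine (vol K) by apply: fine_gt0; rewrite V0 Vf.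
have d0 : 0 < ediam K ^+ n by rewrite exprn_gt0// ediam_gt0.
have dA : 0 < ediam (mximage A K) ^+ n by rewrite exprn_gt0// mximage_ediam_gt0.
rewrite ler_pdivrMr// mulrAC ler_pdivlMr// -mulrA mulrCA.
by rewrite ler_pM2l//.
Qed.

End diameter.

(** * Behrend position *)

Section behrend.
Variable R : realType.

(** A first-order version of the power inequality. The factor [s] is kept on both sides so that one
    statement serves both signs of [s]. *)
Lemma expr_cmp_ln (n i : nat) (a b s : R) : (1 <= i <= n)%N -> -1 < s ->
  0 <= b <= a -> a <= 1 -> (1 + s) ^+ i <= (a + s * b) ^+ n ->
  i%:R * s <= n%:R * (s * b * (1 + s)) /\ 1 - `|s| <= a.
Proof.
move=> /andP[i1 iN] s1 /andP[b0 ba] a1 le_pow.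
have s1_gt0 : 0 < 1 + s by rewrite -ltrBlDl sub0r.
have ab_ge0 : 0 <= a + s * b.
  have [s0|s0] := leP 0 s; first by rewrite addr_ge0 ?mulr_ge0// (le_trans b0).
  nra.
have ab_le : a + s * b <= 1 + s * b by rewrite lerD2r.
have n0 : (0 < n)%N by exact: leq_trans iN.
have ab_gt0 : 0 < a + s * b.
  rewrite lt_def ab_ge0 andbT; apply/eqP => ab0; move: le_pow.
  by rewrite ab0 expr0n gtn_eqF// leNgt exprn_gt0.
have sb1 : 0 < 1 + s * b by exact: lt_le_trans ab_le.
split.
  (* [s / (1 + s) <= ln (1 + s)] and [ln (1 + s b) <= s b] *)
  have : ln ((1 + s) ^+ i) <= ln ((1 + s * b) ^+ n).
    by rewrite ler_ln ?posrE ?exprn_gt0// (le_trans le_pow)// lerXn2r// nnegrE ltW.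
  rewrite !lnXn// => le_ln.
  have h1 : ln (1 + s * b) <= s * b by rewrite le_ln1Dx//; lra.
  have h2 : s / (1 + s) <= ln (1 + s).
    rewrite -lerN2 -lnV ?posrE//.
    have inv1E : (1 + s)^-1 = 1 + (- (s / (1 + s))) by field; rewrite gt_eqF.
    by rewrite [X in ln X]inv1E le_ln1Dx// ltrN2 ltr_pdivrMr// mul1r ltrDr.
  have : i%:R * (s / (1 + s)) <= n%:R * (s * b).
    apply: (@le_trans _ _ (ln (1 + s) *+ i)).
      by rewrite -[leRHS]mulr_natl ler_wpM2l.
    by apply: le_trans le_ln _; rewrite -[leLHS]mulr_natl ler_wpM2l.
  by rewrite mulrA ler_pdivrMr// -!mulrA.
(* For [s >= 0] the power is at least 1, so [a + s * b >= 1] with [b <= 1]. For [s < 0], [i <= n]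
   gives [(1 + s) ^+ n <= (1 + s) ^+ i], so [1 + s <= a + s * b <= a]. *)
have [s0|s0] := leP 0 s.
  have : 1 <= (a + s * b) ^+ n by apply: le_trans le_pow; rewrite exprn_ege1// lerDl.
  rewrite expr_ge1 ?n0// => h.
  have : s * b <= s * 1 by rewrite ler_wpM2l// (le_trans ba).
  by rewrite ger0_norm//; lra.
have : (1 + s) ^+ n <= (a + s * b) ^+ n.
  apply: le_trans le_pow; rewrite ler_wiXn2l// ?ltW//; lra.
rewrite ler_pXn2r ?nnegrE// ?(ltW s1_gt0)// => h.
have : s * b <= 0 by rewrite mulr_le0_ge0// ltW.
by rewrite ltr0_norm//; lra.
Qed.

Lemma dotv_proj_le m (P : 'M[R]_m) u : P^T = P -> P *m P = P ->
  dotv (u *m P) (u *m P) <= dotv u u.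
Proof.
move=> Pt PP; have := dotv_ge0 (u - u *m P).
rewrite -scaleN1r !(dotvDl, dotvDr, dotvZl, dotvZr) (dotvC _ u) !dotv_symidem//.
lra.
Qed.

Lemma dotv_stretch m (P : 'M[R]_m) t u : P^T = P -> P *m P = P ->
  dotv (u + t *: (u *m P)) (u + t *: (u *m P)) =
  dotv u u + ((1 + t) ^+ 2 - 1) * dotv (u *m P) (u *m P).
Proof.
move=> Pt PP; rewrite !(dotvDl, dotvDr, dotvZl, dotvZr) (dotvC _ u) !dotv_symidem//.
ring.
Qed.

Section body.
Variables (n i : nat) (K : set 'rV[R]_n) (L : {vspace 'rV[R]_n}).
Hypotheses (i1n : (1 <= i <= n)%N) (bK : convex_body K)
  (behK : behrend_position K) (Li : \dim L = i).
Variable P : 'M[R]_n.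
Hypotheses (Pt : P^T = P) (PP : P *m P = P)
  (PL : forall v, v *m P \in L) (LP : {in L, forall v, v *m P = v})
  (detP : forall t, \det (1%:M + t *: P) = (1 + t) ^+ \dim L).

Let D := ediam K.
Let a (p : 'rV[R]_n * 'rV[R]_n) := diffsq 1%:M p / D ^+ 2.
Let b (p : 'rV[R]_n * 'rV[R]_n) := diffsq P p / D ^+ 2.
Let n0 : (0 < n)%N. Proof. by case/andP: i1n => i0; exact: leq_trans. Qed.
Let D0 : 0 < D. Proof. exact: ediam_gt0. Qed.
Let cK : compact K. Proof. by case: bK. Qed.
Let K0 : K !=set0.
Proof. by case: bK => _ _ [x /nbhs_singleton Kx]; exists x. Qed.

Let b_ge0 p : 0 <= b p. Proof. by rewrite divr_ge0 ?dotv_ge0// sqr_ge0. Qed.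

Let b_le_a p : b p <= a p.
Proof.
rewrite ler_pM2r ?invr_gt0 ?exprn_gt0// /diffsq mulmx1.
exact: dotv_proj_le.
Qed.

Let a_le1 p : K p.1 -> K p.2 -> a p <= 1.
Proof.
move=> Kp1 Kp2; rewrite ler_pdivrMr ?exprn_gt0// mul1r /diffsq mulmx1 -sqr_enorm.
rewrite lerXn2r ?nnegrE ?enorm_ge0 ?(ltW D0)//.
by have [+ _] := ediamP cK K0; exact.
Qed.

Lemma behrend_stretch (s : R) : -1 < s -> exists p, [/\ K p.1, K p.2,
  i%:R * s <= n%:R * (s * b p * (1 + s)) & 1 - `|s| <= a p].
Proof.
move=> s1; have s1_gt0 : 0 < 1 + s by rewrite -ltrBlDl sub0r.
pose t := Num.sqrt (1 + s) - 1; have tE : (1 + t) ^+ 2 = 1 + s.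
  by rewrite /t addrC subrK sqr_sqrtr// ltW.
have t1 : 0 < 1 + t by rewrite /t addrC subrK sqrtr_gt0.
pose A := 1%:M + t *: P.
have uA : A \in unitmx by rewrite unitmxE detP unitfE expf_neq0// gt_eqF.
have : idq (mximage A K) <= idq K by have [_] := behK; apply; exists A.
rewrite idq_leP// detP Li.
have [_ [x [y [Kx Ky ->]]]] := ediam_mximage A cK K0.
rewrite ger0_norm ?exprn_ge0 ?(ltW t1)// -/D => le1.
have le2 : (1 + s) ^+ i <= (a (x, y) + s * b (x, y)) ^+ n.
  have -> : a (x, y) + s * b (x, y) = (enorm ((x - y) *m A^T) / D) ^+ 2.
    rewrite expr_div_n sqr_enorm /a /b /diffsq /= mulmx1 /A.
    rewrite raddfD/= linearZ/= trmx1 Pt mulmxDr mulmx1 -scalemxAr.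
    rewrite dotv_stretch// tE addrAC subrr add0r.
    by field; rewrite gt_eqF.
  (* The claim is the square of [le1] divided by [D ^+ n]. *)
  rewrite -tE -!exprM (mulnC 2%N i) (mulnC 2%N n) !exprM.
  rewrite lerXn2r ?nnegrE ?exprn_ge0 ?divr_ge0 ?enorm_ge0 ?(ltW t1) ?(ltW D0)//.
  by rewrite expr_div_n ler_pdivlMr// exprn_gt0.
have [] := expr_cmp_ln i1n s1 _ _ le2; rewrite ?b_ge0 ?b_le_a ?a_le1//.
by exists (x, y).
Qed.

Let continuous_ratio (M : 'M[R]_n) : continuous (fun p => diffsq M p / D ^+ 2).
Proof. by move=> p; apply: cvgM; [exact: continuous_diffsq|exact: cvg_cst]. Qed.

Let diametrical p : K p.1 -> K p.2 -> 1 <= a p ->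
  diametrical_directions K (D^-1 *: (p.1 - p.2)) /\
  angle L (D^-1 *: (p.1 - p.2)) = acos (Num.sqrt (b p)).
Proof.
move=> Kp1 Kp2 a1; have dE : enorm (p.1 - p.2) = D.
  have aE : a p = 1 by apply/eqP; rewrite eq_le a_le1.
  apply/eqP; rewrite -(eqrXn2 (_ : (0 < 2)%N)) ?enorm_ge0 ?(ltW D0)//.
  by rewrite sqr_enorm -(mul1r (D ^+ 2)) -aE /a /diffsq mulmx1 divfK// expf_neq0// gt_eqF.
split; first by exists p.1, p.2; rewrite dE.
rewrite (angleE Pt)// ?Li; last first.
- by rewrite enormZ dE gtr0_norm ?invr_gt0// mulVf// gt_eqF.
- by case/andP: i1n.
by rewrite /enorm -scalemxAl dotvZl dotvZr mulrA -expr2 exprVn mulrC.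
Qed.

(** This replaces the passage to the limit: the maximum of [f] over pairs of points of [K] cannot be
    negative. The bound [r <= 2^-1] keeps the parameter [- r] above -1 later. *)
Let attained (f : 'rV[R]_n * 'rV[R]_n -> R) (c : R) : continuous f ->
  0 < c ->
  (forall r, 0 < r -> r <= 2^-1 -> exists p, [/\ K p.1, K p.2 & - (c * r) <= f p]) ->
  exists p, [/\ K p.1, K p.2 & 0 <= f p].
Proof.
move=> cf c0 fP; have KK0 : K `*` K !=set0.
  by have [x Kx] := K0; exists (x, x).
have [p /set_mem[Kp1 Kp2] pmax] :=
  compact_EVT_max KK0 (compact_setX cK cK) (continuous_subspaceT cf).
exists p; split => //; rewrite leNgt; apply/negP => fp0.
(* For this [r] some pair has value at least [- (c * r) >= f p / 2 > f p], against maximality. *)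
pose r := Num.min 2^-1 (- f p / (2 * c)).
have r0 : 0 < r by rewrite lt_min invr_gt0 ltr0n/= divr_gt0 ?oppr_gt0 ?mulr_gt0.
have [|q [Kq1 Kq2 fq]] := fP r r0; first by rewrite ge_min lexx.
have /pmax : q \in K `*` K by rewrite inE.
have rle : r <= - f p / (2 * c) by rewrite ge_min lexx orbT.
have : c * r <= - f p / 2.
  apply: (@le_trans _ _ (c * (- f p / (2 * c)))); first by rewrite ler_wpM2l// ltW.
  by rewrite le_eqVlt; apply/orP; left; apply/eqP; field; rewrite gt_eqF.
lra.
Qed.

Let in_le1 : (i%:R / n%:R : R) <= 1.
Proof. by case/andP: i1n => _ le_in; rewrite ler_pdivrMr ?ltr0n// mul1r ler_nat. Qed.

Let stretch_ratio (s : R) p : i%:R * s <= n%:R * (s * b p * (1 + s)) ->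
  i%:R / n%:R * s <= s * b p * (1 + s).
Proof.
have nR0 : 0 < n%:R :> R by rewrite ltr0n.
move=> h; rewrite -(ler_pM2l nR0); apply: le_trans h.
have -> // : n%:R * (i%:R / n%:R * s) = i%:R * s by field; rewrite gt_eqF.
Qed.

Lemma behrend_small_angle : exists v, diametrical_directions K v /\
  angle L v <= acos (Num.sqrt (i%:R / n%:R)).
Proof.
(* The minimum makes a single pair satisfy both limit inequalities. The constant 1 suffices because
   [b p * (1 + r) >= i%:R / n%:R] and [b p <= 1]. *)
have [||r r0 r2|p [Kp1 Kp2]] := @attained (fun p => Num.min (a p - 1) (b p - i%:R / n%:R)) 1.
- move=> p; apply: (@continuous_min R _ (fun p => a p - 1) (fun p => b p - i%:R / n%:R)).
    by apply: cvgB; [exact: continuous_ratio|exact: cvg_cst].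
  by apply: cvgB; [exact: continuous_ratio|exact: cvg_cst].
- exact: ltr01.
- have [|p [Kp1 Kp2 /stretch_ratio h1 h2]] := @behrend_stretch r; first by lra.
  exists p; split => //; rewrite mul1r le_min; apply/andP; split.
    by rewrite gtr0_norm// in h2; lra.
  have : i%:R / n%:R <= b p * (1 + r) by rewrite -(ler_pM2l r0) mulrC mulrA.
  have := b_le_a p; have := a_le1 Kp1 Kp2; have := b_ge0 p; nra.
rewrite le_min !subr_ge0 => /andP[ap bp].
have [dv aE] := diametrical Kp1 Kp2 ap; exists (D^-1 *: (p.1 - p.2)); split => //.
rewrite aE ler_acos// ?ler_wsqrtr//.
  by rewrite (le_trans _ (sqrtr_ge0 _))// lerN10.
by rewrite -[leRHS]sqrtr1 ler_wsqrtr// (le_trans (b_le_a p)) ?a_le1.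
Qed.

Lemma behrend_large_angle : exists v, diametrical_directions K v /\
  acos (Num.sqrt (i%:R / n%:R)) <= angle L v.
Proof.
(* Here [s = - r], and dividing by it reverses the inequality: [b p * (1 - r) <= i%:R / n%:R],
   whence both defects stay within [2 * r]. *)
have [||r r0 r2|p [Kp1 Kp2]] := @attained (fun p => Num.min (a p - 1) (i%:R / n%:R - b p)) 2.
- move=> p; apply: (@continuous_min R _ (fun p => a p - 1) (fun p => i%:R / n%:R - b p)).
    by apply: cvgB; [exact: continuous_ratio|exact: cvg_cst].
  by apply: cvgB; [exact: cvg_cst|exact: continuous_ratio].
- exact: ltr0n.
- have [|p [Kp1 Kp2 /stretch_ratio h1 h2]] := @behrend_stretch (- r); first by lra.
  exists p; split => //; rewrite le_min; apply/andP; split.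
    by rewrite normrN gtr0_norm// in h2; lra.
  have h3 : b p * (1 - r) <= i%:R / n%:R.
    by rewrite -(ler_pM2l r0); move: h1; set q := _ / _ => h1; lra.
  have := b_le_a p; have := a_le1 Kp1 Kp2; have := b_ge0 p; have := in_le1; nra.
rewrite le_min !subr_ge0 => /andP[ap bp].
have [dv aE] := diametrical Kp1 Kp2 ap; exists (D^-1 *: (p.1 - p.2)); split => //.
rewrite aE ler_acos// ?ler_wsqrtr//.
  by rewrite (le_trans _ (sqrtr_ge0 _))// lerN10.
by rewrite -[leRHS]sqrtr1 ler_wsqrtr.
Qed.

End body.
End behrend.

(** * The cube *)

Section cube.
Variables (R : realType) (n : nat).
Hypothesis n_gt0 : (0 < n)%N.
Notation C := (cube R n).

Lemma compact_cube : compact C.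
Proof.
have := @rV_compact R n (fun=> `[-1, 1]%classic) (fun=> @segment_compact _ _ _).
by congr compact; apply/seteqP; split => x /= xC j; have := xC j; rewrite in_itv.
Qed.

Lemma convex_body_cube : convex_body C.
Proof.
split; first exact: compact_cube.
- move=> x y l; rewrite !inE => Cx Cy j.
  have l0 : 0 <= l%:num by [].
  have l1 : l%:num <= 1 by [].
  have -> : conv l x y = l%:num *: (x : 'rV[R]_n) + (1 - l%:num) *: (y : 'rV[R]_n) by [].
  have := Cx j; have := Cy j; rewrite !mxE.
  move=> /andP[? ?] /andP[? ?]; apply/andP; split; nra.
- exists 0; apply/nbhs_ballP; exists 1 => //= x [_ Bx] j.
  by have := Bx 0 j; rewrite /ball/= mxE sub0r normrN ltr_norml => /andP[/ltW -> /ltW ->].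
Qed.

Lemma sqr_cube_diff (x y : 'rV[R]_n) j : C x -> C y -> (x - y) 0 j ^+ 2 <= 4.
Proof.
move=> Cx Cy; have := Cx j; have := Cy j; rewrite !mxE => /andP[? ?] /andP[? ?]; nra.
Qed.

Lemma cube_signs (e : 'I_n -> R) : (forall j, `|e j| = 1) -> C (\row_j e j).
Proof. by move=> e1 j; rewrite mxE -ler_norml e1. Qed.

Lemma cubeN x : C x -> C (- x).
Proof. by move=> Cx j; rewrite mxE lerN2 lerNl andbC; exact: Cx. Qed.

Lemma cube_neq0 : C !=set0.
Proof. by exists (\row_j 1); apply: cube_signs => j; rewrite normr1. Qed.

Lemma sqr_ediam_cube : ediam C ^+ 2 = n%:R * 4.
Proof.
have sumE : n%:R * 4 = \sum_(j < n) 4 :> R by rewrite sumr_const card_ord mulr_natl.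
have [ub [x [y [Cx Cy DE]]]] := ediamP compact_cube cube_neq0.
apply/eqP; rewrite eq_le; apply/andP; split.
  rewrite DE sqr_enorm dotvE sumE ler_sum// => j _.
  by rewrite -expr2 sqr_cube_diff.
(* This vertex and its opposite are at squared distance [n%:R * 4]. *)
have C1 : C (\row_j 1) by apply: cube_signs => j; rewrite normr1.
have := ub _ _ C1 (cubeN C1).
rewrite -(@ler_pXn2r _ 2) ?nnegrE ?enorm_ge0// ?DE ?enorm_ge0//.
apply: le_trans; rewrite sqr_enorm dotvE sumE ler_sum// => j _.
by rewrite !mxE; lra.
Qed.

Lemma behrend_position_cube : behrend_position C.
Proof.
split; first by exists 1%:M; [exact: unitmx1|rewrite mximage1].
move=> _ [A uA <-]; rewrite idq_leP//; last exact: convex_body_cube.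
have uAT : A^T \in unitmx by rewrite unitmx_tr.
have [ub _] := ediam_mximage A compact_cube cube_neq0.
(* The rows of [A^T] are the columns of [A], so [w] is the image of the vertex [e], and the images
   of [e] and [- e] are at distance [2 * enorm w]. *)
have [e [e1 le_e]] := sign_sum (fun j => row j A^T).
set S := \sum_j _ in le_e; set w := \sum_j _ in le_e.
have wE : w = (\row_j e j) *m A^T.
  by rewrite mulmx_sum_row; apply: eq_bigr => j _; rewrite mxE.
have Ce := cube_signs e1; have := ub _ _ Ce (cubeN Ce).
set D := ediam (mximage A C); rewrite opprK mulmxDl -wE => le_D.
have D0 : 0 <= D by rewrite (le_trans _ le_D)// enorm_ge0.
have S0 : 0 <= S by rewrite sumr_ge0// => j _; exact: dotv_ge0.
have le_S : S * 4 <= D ^+ 2.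
  apply: (@le_trans _ _ (enorm (w + w) ^+ 2)).
    by rewrite sqr_enorm !(dotvDl, dotvDr); lra.
  by rewrite lerXn2r ?nnegrE ?enorm_ge0.
(* After squaring, [sqr_det_le] and [sqr_ediam_cube] apply. *)
rewrite -(@ler_pXn2r _ 2) ?nnegrE ?mulr_ge0 ?exprn_ge0//; last first.
  by apply: ltW; apply: ediam_gt0 => //; exact: convex_body_cube.
rewrite exprMn real_normK ?num_real// -!exprM (mulnC n 2) !exprM sqr_ediam_cube.
rewrite -det_tr.
apply: (@le_trans _ _ ((S * 4) ^+ n)); last first.
  by rewrite lerXn2r ?nnegrE ?mulr_ge0 ?exprn_ge0.
apply: (@le_trans _ _ ((S / n%:R) ^+ n * (n%:R * 4) ^+ n)).
  by rewrite ler_wpM2r ?exprn_ge0 ?mulr_ge0// sqr_det_le.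
by rewrite -exprMn mulrA divfK// pnatr_eq0 -lt0n.
Qed.

(** Each squared coordinate difference is at most 4, and the sum reaches [n%:R * 4] only if all of
    them equal 4. *)
Lemma cube_diametrical_entry v j : diametrical_directions C v ->
  v 0 j ^+ 2 = n%:R^-1.
Proof.
move=> [x [y [Cx Cy dE ->]]]; rewrite mxE exprMn exprVn dE sqr_ediam_cube.
have /(congr1 (fun d => d ^+ 2)) := dE; rewrite sqr_enorm dotvE sqr_ediam_cube.
move=> sumE; have sum0 : \sum_j (4 - (x - y) 0 j ^+ 2) = 0.
  rewrite sumrB sumr_const card_ord -[4 *+ n]mulr_natl -sumE;
  by under [X in _ - X]eq_bigr do rewrite expr2; rewrite subrr.
move/eqP: sum0; rewrite psumr_eq0 => [/allP|k _]; last by rewrite subr_ge0 sqr_cube_diff.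
move=> /(_ j (mem_index_enum j)); rewrite subr_eq0 => /eqP <-.
by rewrite invfM divfK.
Qed.

Section coordinate_subspace.
Variable i : nat.
Hypothesis i1n : (1 <= i <= n)%N.
Notation L := (coord_subspace R n i).

Definition coord_proj : 'M[R]_n := \matrix_(k, j) ((k == j) && (j < i)%N)%:R.

Lemma mul_coord_proj (v : 'rV[R]_n) j : (v *m coord_proj) 0 j = v 0 j *+ (j < i)%N.
Proof.
rewrite mxE (bigD1 j)//= big1 => [|k kj]; rewrite mxE.
  by rewrite eqxx addr0 mulr_natr.
by rewrite (negbTE kj) mulr0.
Qed.

Lemma coord_proj_tr : coord_proj^T = coord_proj.
Proof. by apply/matrixP => k j; rewrite !mxE eq_sym; case: eqVneq => // ->. Qed.

Lemma coord_proj_mem v : v *m coord_proj \in L.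
Proof.
rewrite (row_sum_delta (v *m coord_proj)) memv_suml// => j _; rewrite mul_coord_proj.
case: ltnP => ji; last by rewrite scale0r mem0v.
apply/memvZ/memv_span/mapP; exists j => //; by rewrite mem_filter ji mem_enum.
Qed.

Lemma coord_proj_id : {in L, forall v, v *m coord_proj = v}.
Proof.
move=> v; rewrite /coord_subspace; set s := map _ _.
rewrite -[s]/(tval (in_tuple s)) => /coord_span ->.
rewrite mulmx_suml; apply: eq_bigr => k _; rewrite -scalemxAl; congr (_ *: _).
have /mapP[j] := mem_nth 0 (ltn_ord k : (k < size (in_tuple s))%N).
rewrite mem_filter => /andP[ji _] ->; apply/rowP => l.
by rewrite mul_coord_proj !mxE eqxx/=; case: (eqVneq l j) => [->|_]; rewrite ?ji ?mul0rn.
Qed.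

Lemma dim_coord_subspace : \dim L = i.
Proof.
pose s : seq 'rV[R]_n := [seq delta_mx ord0 k | k <- enum 'I_n].
have fs : free s.
  rewrite /free size_map size_enum_ord; apply/eqP.
  have -> : span s = fullv.
    apply/vspaceP => v; rewrite memvf (row_sum_delta v) memv_suml// => j _.
    by apply/memvZ/memv_span/map_f; rewrite mem_enum.
  by rewrite dimvf dim_matrix; exact: mul1n.
(* The selection of indices is rewritten as a filter on the vectors, so that freeness passes from
   the full list of unit vectors. *)
have sE : [seq delta_mx ord0 k | k : 'I_n <- enum 'I_n & (k < i)%N] =
    [seq v : 'rV[R]_n <- s | [exists k : 'I_n, (k < i)%N && (v 0 k != 0)]].
  rewrite [RHS]filter_map; congr map; apply: eq_filter => k /=.
  apply/idP/existsP => [ki|[l]]; first by exists k; rewrite ki mxE !eqxx oner_neq0.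
  by rewrite mxE; case: (eqVneq l k) => [-> /andP[]//|_]; rewrite andbF eqxx andbF.
rewrite /coord_subspace sE (eqP (filter_free _ fs)) -sE size_map size_filter.
case/andP: i1n => _ le_in.
by rewrite -sum1_count big_enum_cond (big_ord_narrow le_in) sum1_card card_ord.
Qed.

(** The projection keeps [i] entries of square [n%:R^-1]. As every diametrical direction of the cube
    makes this same angle, both bounds are sharp at once. *)
Lemma angle_cube_coord_subspace v : diametrical_directions C v ->
  angle L v = acos (Num.sqrt (i%:R / n%:R)).
Proof.
move=> Dv; have vE j := cube_diametrical_entry j Dv.
have [i0 le_in] := andP i1n.
rewrite (angleE coord_proj_tr coord_proj_mem coord_proj_id).
- rewrite /enorm dotvE (eq_bigr (fun j : 'I_n => if (j < i)%N then n%:R^-1 else 0)).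
    rewrite -big_mkcond /=.
    by rewrite (big_ord_narrow le_in) sumr_const card_ord -[_^-1 *+ _]mulr_natl.
  move=> j _; rewrite mul_coord_proj mulrnAl mulrnAr -expr2 vE.
  by case: (j < i)%N; rewrite ?mul0rn.
- by rewrite dim_coord_subspace.
- rewrite /enorm dotvE; under eq_bigr do rewrite -expr2 vE.
  by rewrite sumr_const card_ord -[_^-1 *+ _]mulr_natl divff ?sqrtr1// pnatr_eq0 -lt0n.
Qed.

End coordinate_subspace.

End cube.

Theorem lemma3p2 (R : realType) (n i : nat) (hi : (1 <= i <= n.-1)%N) :
  (forall K : set 'rV[R]_n, convex_body K -> behrend_position K ->
     forall L : {vspace 'rV[R]_n}, \dim L = i ->
       (exists v, diametrical_directions K v /\
          angle L v <= acos (Num.sqrt (i%:R / n%:R))) /\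
       (exists w, diametrical_directions K w /\
          angle L w >= acos (Num.sqrt (i%:R / n%:R)))) /\
  (convex_body (cube R n) /\ behrend_position (cube R n) /\
   \dim (coord_subspace R n i) = i /\
   (forall c : R, c < acos (Num.sqrt (i%:R / n%:R)) ->
      ~ exists v, diametrical_directions (cube R n) v /\
          angle (coord_subspace R n i) v <= c) /\
   (forall c : R, c > acos (Num.sqrt (i%:R / n%:R)) ->
      ~ exists w, diametrical_directions (cube R n) w /\
          angle (coord_subspace R n i) w >= c)).
Proof.
have i1n : (1 <= i <= n)%N.
  by case/andP: hi => -> /leq_trans; apply; exact: leq_pred.
have n0 : (0 < n)%N by case/andP: i1n; exact: leq_trans.
split.
  move=> K bK behK L Li; have [P [Pt PP PL LP detP]] := orthogonal_projection L.
  split; first exact: (behrend_small_angle i1n bK behK Li Pt PP PL LP detP).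
  exact: (behrend_large_angle i1n bK behK Li Pt PP PL LP detP).
split; first exact: convex_body_cube.
split; first exact: behrend_position_cube.
split; first exact: dim_coord_subspace.
split => c hc [v [Dv]]; rewrite (angle_cube_coord_subspace n0 i1n Dv) leNgt;
  by rewrite hc.
Qed.
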